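(* Let $\mathbb{A}$ be a bounded lattice. Let $\Delta(\mathbb{A})=\langle\mathcal{F}(\mathbb{A});\leq,C_{\mathbb{A}}\rangle$ be the dcpo presentation on the co-directed meet completion of $\mathbb{A}$ defined in the context, and let $\overline{\Delta(\mathbb{A})}$, ordered by inclusion, be the dcpo it generates. Then the map $$e\colon \mathbb{A}\to\overline{\Delta(\mathbb{A})},\qquad e(a)=\langle\uparrow_{\mathbb{A}}a\rangle,$$ where $\langle x\rangle$ denotes the smallest $C_{\mathbb{A}}$-ideal containing $x$, is the canonical extension of $\mathbb{A}$. That is, $\overline{\Delta(\mathbb{A})}$ is a complete lattice, $e$ is a lattice embedding, and $e$ is dense and compact.
   Context: Directed and co-directed sets, filters and ideals are non-empty. $\operatorname{Idl}(\mathbb{A})$ is the set of lattice ideals of $\mathbb{A}$. Co-directed meet completion. For a poset $\mathbb{P}=\langle P,\leq\rangle$, $\uparrow_{\mathbb{P}}\colon\mathbb{P}\to\mathcal{F}(\mathbb{P})$ is the map characterized (up to isomorphism) by: (1) $\mathcal{F}(\mathbb{P})$ is a co-dcpo (a poset with all co-directed meets); (2) $\uparrow_{\mathbb{P}}$ is an order-embedding; (3) for each $x\in\mathcal{F}(\mathbb{P})$ the set $\{a\in P\mid x\leq\uparrow_{\mathbb{P}}a\}$ is co-directed and $x=\bigwedge\{\uparrow_{\mathbb{P}}a\mid x\leq\uparrow_{\mathbb{P}}a\}$; (4) for all co-directed $S\subseteq\mathcal{F}(\mathbb{P})$ and $a\in P$, if $\bigwedge S\leq\uparrow_{\mathbb{P}}a$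 then $s\leq\uparrow_{\mathbb{P}}a$ for some $s\in S$. (Concretely: the filters of $\mathbb{P}$ ordered by reverse inclusion, with $\uparrow_{\mathbb{P}}a$ the principal filter of $a$.) For a bounded lattice $\mathbb{A}$, $\mathcal{F}(\mathbb{A})$ is a complete lattice and $\uparrow_{\mathbb{A}}$ is a lattice embedding. Dcpo presentations. A dcpo presentation $\langle P;\sqsubseteq,C\rangle$ is a preorder $\langle P,\sqsubseteq\rangle$ with a set $C\subseteq P\times\mathcal{P}(P)$ of covers such that $U$ is directed whenever $(x,U)\in C$; write $x\triangleleft U$ for $(x,U)\in C$. A $C$-ideal is a downward closed $X\subseteq P$ such that $x\triangleleft U$ and $U\subseteq X$ imply $x\in X$. The set $C\text{-}\mathrm{Idl}(P)$ of $C$-ideals, ordered by inclusion, is a complete lattice; $\langle X\rangle$ is the smallest $C$-ideal containing $X\subseteq P$, $\langle x\rangle=\langle\{x\}\rangle$, and $\bigvee S=\langle\bigcup S\rangle$. The generated dcpo $\overline{P}$ is the smallest subset of $C\text{-}\mathrm{Idl}(P)$ that contains $\langle x\rangle$ for all $x\in P$ and is closed under directed joins of $C\text{-}\mathrm{Idl}(P)$, ordered by inclusion. The presentation $\Delta(\mathbb{A})$. $\Delta(\mathbb{A})=\langle\mathcal{F}(\mathbb{A});\leq,C_{\mathbb{A}}\rangle$, where $(x,U)\in C_{\mathbb{A}}$ iff $x\in\mathcal{F}(\mathbb{A})$, $U\subseteq\mathcal{F}(\mathbb{A})$ is non-empty and directed, and for every $I\in\operatorname{Idl}(\mathbb{A})$: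 if for all $x'\in U$ there is $a'\in I$ with $x'\leq\uparrow_{\mathbb{A}}a'$, then there is $a\in I$ with $x\leq\uparrow_{\mathbb{A}}a$. Canonical extension. A lattice embedding $e\colon\mathbb{A}\to\mathbb{C}$ into a complete lattice is a canonical extension of $\mathbb{A}$ if it is: (dense) for all $u,v\in\mathbb{C}$ with $u\nleq v$ there are a filter $F$ and an ideal $I$ of $\mathbb{A}$ with $\bigwedge e[F]\leq u$, $\bigwedge e[F]\nleq v$, $v\leq\bigvee e[I]$ and $u\nleq\bigvee e[I]$; and (compact) for all filters $F$ and ideals $I$ of $\mathbb{A}$, if $\bigwedge e[F]\leq\bigvee e[I]$ then there are $b\in F$, $a\in I$ with $b\leq a$. It is unique up to isomorphism of completions of $\mathbb{A}$. *)

(* Defs.v *)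
From HB Require Import structures.
From mathcomp Require Import all_boot all_order.
From mathcomp Require Import mathcomp_extra boolp classical_sets.

Set Implicit Arguments.
Unset Strict Implicit.
Unset Printing Implicit Defensive.

Import Order.TTheory.
Local Open Scope classical_set_scope.
Local Open Scope order_scope.

Section Directed.
Context {d : Order.disp_t} {P : preorderType d}.
Implicit Types S X : set P.

Definition directed S : Prop :=
  S !=set0 /\ forall x y, S x -> S y -> exists z, [/\ S z, x <= z & y <= z].

Definition codirected S : Prop :=
  S !=set0 /\ forall x y, S x -> S y -> exists z, [/\ S z, z <= x & z <= y].

Definition down_closed X : Prop := forall x y, X y -> x <= y -> X x.

Definition up_closed X : Prop := forall x y, X x -> x <= y -> X y.

End Directed.

Section LatticeFilters.
Context {d : Order.disp_t} {A : latticeType d}.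

Definition lattice_ideal (I : set A) : Prop :=
  [/\ I !=set0, down_closed I & forall a b, I a -> I b -> I (a `|` b)%O].

Definition lattice_filter (F : set A) : Prop :=
  [/\ F !=set0, up_closed F & forall a b, F a -> F b -> F (a `&` b)%O].

End LatticeFilters.

(* [infimums S m] (resp. [supremums S m]) says that the meet (resp. join) of S
   exists and is m; all meets and joins below are handled through it. *)

Definition co_dcpo d (C : porderType d) : Prop :=
  forall S : set C, codirected S -> exists m, infimums S m.

Definition complete_lattice d (C : porderType d) : Prop :=
  forall S : set C, (exists m, infimums S m) /\ (exists j, supremums S j).

Definition codirected_meet_completion d d' (P : porderType d)
    (F : porderType d') (up : P -> F) : Prop :=
  [/\ co_dcpo F,
      {mono up : a b / a <= b},
      (forall x : F, codirected [set a | x <= up a] /\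
                     infimums (up @` [set a | x <= up a]) x) &
      (forall (S : set F) (m : F) (a : P), codirected S -> infimums S m ->
         m <= up a -> exists2 s, S s & s <= up a)].

(* Existence of the completion: filters ordered by reverse inclusion. *)
Section FilterCompletion.
Context {d : Order.disp_t} {P : porderType d}.

Definition poset_filters : set (set P) := [set X | up_closed X /\ codirected X].

Definition poset_filter : Type := {X : set P | X \in poset_filters}.

HB.instance Definition _ := SubChoice.on poset_filter.
HB.instance Definition _ :=
  [SubChoice_isSubPOrder of poset_filter by <: with set_display].

Lemma up_setP (a : P) : poset_filters [set b | a <= b].
Proof.
split=> [x y /= ax xy|]; first exact: le_trans ax xy.
by split=> [|x y ax ay]; exists a => //=; split=> //=.
Qed.

Definition principal_filter (a : P) : poset_filter^d :=
  SigSub (mem_set (up_setP a)).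

Lemma poset_filterP (X : poset_filter) : poset_filters (val X).
Proof. exact: set_mem (valP X). Qed.

Lemma le_filterE (X Y : poset_filter^d) :
  (X <= Y) = (val (Y : poset_filter) `<=` val (X : poset_filter)) :> Prop.
Proof. by rewrite -leEdual -Order.le_val subsetEset. Qed.

Lemma le_principal (X : poset_filter^d) (a : P) :
  (X <= principal_filter a) = val (X : poset_filter) a :> Prop.
Proof.
rewrite le_filterE; apply/propext; split=> [|Xa b /=]; first by apply => /=.
by case: (poset_filterP X) => upX _; exact: upX Xa.
Qed.

Lemma principal_filter_completion :
  codirected_meet_completion principal_filter.
Proof.
have dirU (S : set poset_filter^d) : codirected S ->
    poset_filters (\bigcup_(X in S) val (X : poset_filter)).
  move=> [[X0 SX0] Sdir]; split=> [x y [X SX Xx] xy|].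
    by exists X => //; case: (poset_filterP X) => upX _; exact: upX Xx xy.
  split=> [|x y [X SX Xx] [Y SY Yy]].
    by case: (poset_filterP X0) => _ [[x X0x] _]; exists x; exists X0.
  have [Z [SZ]] := Sdir _ _ SX SY; rewrite !le_filterE => XZ YZ.
  case: (poset_filterP Z) => _ [_ /(_ x y (XZ _ Xx) (YZ _ Yy))] [z [Zz zx zy]].
  by exists z; split => //; exists Z.
have infU S (cS : codirected S) :
    infimums S (SigSub (mem_set (dirU S cS)) : poset_filter^d).
  split=> [X SX|X lX]; rewrite le_filterE /= => x; first by exists X.
  by move=> [Y SY]; have := lX Y SY; rewrite le_filterE; exact.
split.
- by move=> S cS; exists (SigSub (mem_set (dirU S cS)) : poset_filter^d).
- move=> a b; apply/idP/idP; rewrite le_principal //.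
- move=> X; have -> : [set a | X <= principal_filter a] = val (X : poset_filter).
    by apply/seteqP; split=> a /=; rewrite le_principal.
  split; first by case: (poset_filterP X).
  split=> [_ [a Xa <-]|Y lY]; first by rewrite le_principal.
  rewrite le_filterE => a Xa; rewrite -le_principal; apply: lY.
  by exists a.
- move=> S m a cS infm; have -> : m = SigSub (mem_set (dirU S cS)).
    exact: (is_subset1_infimums infm (infU S cS)).
  by rewrite le_principal /= => -[X SX Xa]; exists X => //; rewrite le_principal.
Qed.

End FilterCompletion.

Record dcpo_presentation d (P : preorderType d) := DcpoPresentation {
  cover : P -> set P -> Prop;
  cover_directed : forall x U, cover x U -> directed U }.

Section GeneratedDcpo.
Context {d : Order.disp_t} {P : preorderType d} (C : dcpo_presentation P).

Definition C_ideal (X : set P) : Prop :=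
  down_closed X /\ forall x U, cover C x U -> U `<=` X -> X x.

Definition C_span (X : set P) : set P := smallest C_ideal X.

Definition C_principal (x : P) : set P := C_span [set x].

Definition C_join (S : set (set P)) : set P := C_span (\bigcup_(X in S) X).

(* [directed S] is with respect to inclusion, the canonical order of [set P]. *)
Definition directed_join_closed (D : set (set P)) : Prop :=
  D `<=` C_ideal /\ forall S, S `<=` D -> directed S -> D (C_join S).

Definition generated_sets : set (set P) :=
  smallest directed_join_closed (range C_principal).

Definition generated_dcpo : Type := {X : set P | X \in generated_sets}.

HB.instance Definition _ := SubChoice.on generated_dcpo.
HB.instance Definition _ :=
  [SubChoice_isSubPOrder of generated_dcpo by <: with set_display].

Lemma le_generatedE (X Y : generated_dcpo) :
  (X <= Y) = (val X `<=` val Y) :> Prop.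
Proof. by rewrite -Order.le_val subsetEset. Qed.

Lemma C_principalP (x : P) : generated_sets (C_principal x).
Proof. by apply: sub_gen_smallest; exists x. Qed.

Definition to_generated (x : P) : generated_dcpo :=
  SigSub (mem_set (C_principalP x)).

Lemma C_spanP (X : set P) : C_ideal (C_span X).
Proof.
split=> [x y Xy xy I [idI XI]|x U xU UX I [idI XI]].
  by apply: idI.1 xy; apply: Xy.
by apply: idI.2 xU _ => y Uy; apply: UX.
Qed.

(* [smallest] is an intersection, so it is only a smallest element when it lies
   in the family being intersected; this holds here, as for [C_span]. *)
Lemma directed_join_closed_C_ideal : directed_join_closed C_ideal.
Proof. by split=> // S _ _; exact: C_spanP. Qed.

Lemma generated_setsP : directed_join_closed generated_sets.
Proof.
split=> [|S SD dS D [clD pD]].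
  apply: smallest_sub => [|_ [x _ <-]]; last exact: C_spanP.
  exact: directed_join_closed_C_ideal.
by apply: clD.2 dS => X SX; exact: SD.
Qed.

End GeneratedDcpo.

Section Delta.
Context {d d' : Order.disp_t} {A : tbLatticeType d} {F : porderType d'}.
Variable up : A -> F.

Definition Delta_cover (x : F) (U : set F) : Prop :=
  directed U /\
  forall I : set A, lattice_ideal I ->
    (forall x', U x' -> exists2 a', I a' & x' <= up a') ->
    exists2 a, I a & x <= up a.

Lemma Delta_cover_directed x U : Delta_cover x U -> directed U.
Proof. by case. Qed.

Definition Delta : dcpo_presentation F := DcpoPresentation Delta_cover_directed.

End Delta.

Section CanonicalExtension.
Context {d d' : Order.disp_t} {A : tbLatticeType d} {C : porderType d'}.
Variable e : A -> C.

Definition lattice_embedding : Prop :=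
  [/\ injective e,
      (forall a b, infimums [set e a; e b] (e (a `&` b)%O)) &
      (forall a b, supremums [set e a; e b] (e (a `|` b)%O))].

Definition dense : Prop :=
  forall u v : C, ~ u <= v ->
    exists (F I : set A) (m j : C),
      [/\ lattice_filter F, lattice_ideal I,
          infimums (e @` F) m, supremums (e @` I) j &
          [/\ m <= u, ~ m <= v, v <= j & ~ u <= j]].

Definition compact : Prop :=
  forall (F I : set A) (m j : C),
    lattice_filter F -> lattice_ideal I ->
    infimums (e @` F) m -> supremums (e @` I) j -> m <= j ->
    exists b a, [/\ F b, I a & b <= a].

Definition canonical_extension : Prop :=
  [/\ complete_lattice C, lattice_embedding, dense & compact].

(* [lattice_embedding] does not mention the bounds: density, whose filters and
   ideals are non-empty, forces their preservation. *)
Lemma canonical_extension_bounds : canonical_extension ->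
  (forall x : C, e \bot <= x) /\ (forall x : C, x <= e \top).
Proof.
move=> [_ _ de _]; split=> x; apply: contrapT => /de
    [F [I [m [j [[[b Fb] upF _] [[a Ia] downI _] [lm _] [uj _] [mu mv vj uj']]]]]].
  by apply: uj'; apply: uj; exists \bot => //; exact: downI Ia (le0x _).
by apply: mv; apply: lm; exists \top => //; exact: upF Fb (lex1 _).
Qed.

End CanonicalExtension.

(* Main.v *)
(* Every element x of the filter completion is the meet of the [up a] above it,
   so <x> is the down-set of x, and for an ideal I of A the set
   J_I = {x | x <= up a for some a in I} is a C-ideal, namely the join of e[I].
   Covers are stable under binary joins of the completion, so the generated dcpo
   consists exactly of the directed C-ideals; this family is closed under
   intersections, hence a complete lattice. If X is a directed C-ideal and x lies
   in every J_I containing X, then X itself covers x; thus X is the intersection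
   of such J_I, which is density. Compactness is axiom (4) of the completion. *)
Require Import Defs.
From mathcomp Require Import all_boot all_order.
From mathcomp Require Import mathcomp_extra boolp classical_sets.

Set Implicit Arguments.
Unset Strict Implicit.
Unset Printing Implicit Defensive.

Import Order.TTheory.
Local Open Scope classical_set_scope.
Local Open Scope order_scope.

Section MeetCompletion.
Context {d d' : Order.disp_t} {A : tbLatticeType d} {F : porderType d'}.
Context {up : A -> F} (upP : codirected_meet_completion up).
Implicit Types (x y z : F) (a b : A) (I : set A) (X : set F).

(** * Lattice structure of the completion *)

Let up_mono : {mono up : a b / a <= b}. Proof. by case: upP. Qed.

Lemma le_up x y : (forall a, y <= up a -> x <= up a) -> x <= y.
Proof.
move=> xy; case: upP => _ _ /(_ y)[_ [_ ymax]] _.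
by apply: ymax => _ [a ya <-]; exact: xy.
Qed.

(** The converse direction uses that the elements [c] with [x <= up c] form a co-directed set: [a]
    and [b] have a lower bound in it. *)
Lemma le_up_meet x a b : (x <= up (a `&` b)%O) = (x <= up a) && (x <= up b).
Proof.
apply/idP/andP => [xab|[xa xb]].
  by split; apply: le_trans xab _; rewrite up_mono ?leIl ?leIr.
case: upP => _ _ /(_ x)[[_ /(_ a b xa xb)[c [/= xc ca cb]]] _] _.
by apply: le_trans xc _; rewrite up_mono lexI ca.
Qed.

Lemma le_up_top x : x <= up \top.
Proof.
case: upP => _ _ /(_ x)[[[a /= xa] _] _] _.
by apply: le_trans xa _; rewrite up_mono lex1.
Qed.

Lemma up_bot_le x : up \bot <= x.
Proof. by apply: le_up => a _; rewrite up_mono le0x. Qed.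

Lemma up_join_le a b x : (up (a `|` b)%O <= x) = (up a <= x) && (up b <= x).
Proof.
apply/idP/andP => [abx|[ax bx]].
  by split; apply: le_trans abx; rewrite up_mono ?leUl ?leUr.
apply: le_up => c xc; rewrite up_mono leUx -!up_mono.
by rewrite (le_trans ax xc) (le_trans bx xc).
Qed.

(** Only co-directed meets are available, so the join of [x] and [y] is taken as the meet of the
    [up a] above both. That family is co-directed because such [a] are closed under meets and
    include the top. *)
Lemma completion_join :
  exists j : F -> F -> F, forall x y z, (j x y <= z) = (x <= z) && (y <= z).
Proof.
suff /choice[j jP] (p : F * F) :
    exists m, forall z, (m <= z) = (p.1 <= z) && (p.2 <= z).
  by exists (fun x y => j (x, y)) => x y z; exact: (jP (x, y)).
case: p => x y; pose S := [set a | (x <= up a) && (y <= up a)].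
have codirS : codirected (up @` S).
  split; first by exists (up \top), \top => //; rewrite /S /= !le_up_top.
  move=> _ _ [a /andP[xa ya] <-] [b /andP[xb yb] <-].
  exists (up (a `&` b)%O); split; rewrite ?up_mono ?leIl ?leIr //.
  by exists (a `&` b)%O; rewrite /S //= !le_up_meet xa xb ya yb.
case: upP => /(_ _ codirS)[m [lm mmax]] _ _ _; exists m => z /=.
have xm : x <= m by apply: mmax => _ [a /andP[xa _] <-].
have ym : y <= m by apply: mmax => _ [a /andP[_ ya] <-].
apply/idP/andP => [mz|[xz yz]]; first by rewrite (le_trans xm) ?(le_trans ym).
apply: le_up => a za; apply: lm; exists a => //.
by rewrite /S /= (le_trans xz za) (le_trans yz za).
Qed.

(** * Cones of ideals and principal C-ideals *)

Definition ideal_cone I : set F := [set x | exists2 a, I a & x <= up a].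

Lemma ideal_cone_C_ideal I : lattice_ideal I -> C_ideal (Delta up) (ideal_cone I).
Proof.
move=> idI; split=> [x y [a Ia ya] xy|x U [_ xU] UI].
  by exists a => //; exact: le_trans xy ya.
by apply: xU => // x' /UI.
Qed.

Lemma ideal_cone_directed I : lattice_ideal I -> directed (ideal_cone I).
Proof.
move=> [[a0 Ia0] _ joinI]; split; first by exists (up a0), a0.
move=> x y [a Ia xa] [b Ib yb]; exists (up (a `|` b)%O); split.
- by exists (a `|` b)%O => //; exact: joinI.
- by apply: le_trans xa _; rewrite up_mono leUl.
- by apply: le_trans yb _; rewrite up_mono leUr.
Qed.

Lemma principal_ideal a : lattice_ideal [set b | b <= a].
Proof.
split=> [|x y /= ya xy|x y /= xa ya]; first by exists a => /=.
- exact: le_trans xy ya.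
- by rewrite leUx xa.
Qed.

Lemma C_principalE x : C_principal (Delta up) x = [set y | y <= x].
Proof.
apply/seteqP; split=> [y|y /= yx X [[downX _] Xx]]; last exact: downX (Xx x erefl) yx.
apply; split=> [|_ -> /=]; last exact: lexx.
split=> [z t /= tx zt|z U [_ zU] Ux].
  exact: le_trans zt tx.
(* A cover of [z] inside the down-set of [x] is tested against the principal ideal of each [a] with
   [x <= up a]. *)
apply: le_up => a xa; have [|b /= ba zb] := zU _ (principal_ideal a).
  by move=> t /Ux /= tx; exists a => //=; exact: le_trans tx xa.
by apply: le_trans zb _; rewrite up_mono.
Qed.

(** * Directed C-ideals *)

Lemma Delta_cover_join j x y (U : set F) :
  (forall x y z, (j x y <= z) = (x <= z) && (y <= z)) ->
  Delta_cover up x U -> Delta_cover up (j x y) [set j u y | u in U].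
Proof.
move=> jP [[[u0 Uu0] dirU] xU]; split.
  split; first by exists (j u0 y), u0.
  move=> _ _ [u Uu <-] [v Uv <-]; have [w [Uw uw vw]] := dirU u v Uu Uv.
  have := lexx (j w y); rewrite jP => /andP[wj yj].
  exists (j w y); split; first by exists w.
  - by rewrite jP yj (le_trans uw wj).
  - by rewrite jP yj (le_trans vw wj).
move=> I idI UI; have [|a Ia xa] := xU I idI.
  move=> u Uu; have [|a Ia] := UI (j u y); first by exists u.
  by rewrite jP => /andP[ua _]; exists a.
(* Non-emptiness of [U] is what bounds [y] by an element of [I]; the join of the two bounds then
   works. *)
have [|b Ib] := UI (j u0 y); first by exists u0.
rewrite jP => /andP[_ yb]; case: idI => _ _ joinI.
exists (a `|` b)%O; first exact: joinI.
rewrite jP (le_trans xa) ?(le_trans yb) // up_mono ?leUl ?leUr //.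
Qed.

(** The span is shown closed under binary joins, using its minimality twice: first to join an
    element of the span with one of [X], then, by commutativity of [j], two elements of the span. *)
Lemma C_span_directed X :
  down_closed X -> directed X -> directed (C_span (Delta up) X).
Proof.
have [j jP] := completion_join => downX [[x0 Xx0] dirX].
have [spanX sX] : C_ideal (Delta up) (C_span (Delta up) X) /\
    X `<=` C_span (Delta up) X.
  by split; [exact: C_spanP | exact: sub_gen_smallest].
set W := C_span (Delta up) X in spanX sX *.
have jl x y : x <= j x y by have := lexx (j x y); rewrite jP => /andP[].
have jr x y : y <= j x y by have := lexx (j x y); rewrite jP => /andP[].
have jC x y : j x y = j y x by apply: le_anti; rewrite !jP !jl !jr.
have jX x y : X x -> X y -> X (j x y).
  move=> Xx Xy; have [z [Xz xz yz]] := dirX x y Xx Xy.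
  by apply: downX Xz _; rewrite jP xz.
(* Stability of covers under [j _ y] makes this preimage of [W] a C-ideal, so it contains [W] as
   soon as it contains [X]. *)
have idealW y : C_ideal (Delta up) [set x | W (j x y)].
  split=> [x x' /= Wx' xx'|x U /(Delta_cover_join y jP) jxU UW /=].
    by apply: spanX.1 Wx' _; rewrite jP jr (le_trans xx').
  by apply: spanX.2 jxU _ => _ [u Uu <-]; exact: UW.
have jXW x y : W x -> X y -> W (j x y).
  move=> Wx Xy; apply: (Wx [set x | W (j x y)]); split => // x' Xx' /=.
  by apply: sX; exact: jX.
have jW x y : W x -> W y -> W (j x y).
  move=> Wx Wy; apply: (Wx [set x | W (j x y)]); split => // x' Xx' /=.
  by rewrite jC; exact: jXW.
split; first by exists x0; exact: sX.
by move=> x y Wx Wy; exists (j x y); split; rewrite ?jl ?jr //; exact: jW.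
Qed.

Lemma generated_setsE X :
  generated_sets (Delta up) X <-> C_ideal (Delta up) X /\ directed X.
Proof.
split=> [genX|[idX [[x0 Xx0] dirX]]].
  (* By minimality, it suffices that directed C-ideals are closed under directed joins: the union of
     a directed family of them is down-closed and directed, so its span is directed. *)
  apply: (genX [set Y | C_ideal (Delta up) Y /\ directed Y]); split=> [|_ [x _ <-]].
    split=> [Y []//|S SD [[Y0 SY0] dirS]]; split; first exact: C_spanP.
    apply: C_span_directed => [x y [Y SY Yy] xy|].
      by exists Y => //; exact: (SD Y SY).1.1 Yy xy.
    have [_ [[y0 Yy0] _]] := SD _ SY0.
    split=> [|x y [Y SY Yx] [Z SZ Zy]]; first by exists y0, Y0.
    have [V [SV]] := dirS Y Z SY SZ; rewrite !subsetEset => YV ZV.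
    have [_ [_ /(_ x y (YV _ Yx) (ZV _ Zy))[z [Vz xz yz]]]] := SD _ SV.
    by exists z; split=> //; exists V.
  split; first exact: C_spanP.
  rewrite C_principalE; split=> [|y z yx zx]; first by exists x => /=.
  by exists x; split => //=.
have [_ clG] := generated_setsP (Delta up).
(* Conversely, a directed C-ideal is the directed join of the principal C-ideals of its elements. *)
have -> : X = C_join (Delta up) [set C_principal (Delta up) x | x in X].
  apply/seteqP; split=> [x Xx|x].
    apply: sub_gen_smallest; exists (C_principal (Delta up) x); first by exists x.
    by rewrite C_principalE /=.
  apply; split=> // y [_ [z Xz <-]]; rewrite C_principalE => yz.
  exact: idX.1 Xz yz.
apply: clG => [_ [x _ <-]|]; first exact: C_principalP.
split; first by exists (C_principal (Delta up) x0), x0.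
move=> _ _ [x Xx <-] [y Xy <-]; have [z [Xz xz yz]] := dirX x y Xx Xy.
exists (C_principal (Delta up) z); split; first by exists z.
- by rewrite subsetEset !C_principalE => t /= /le_trans; apply.
- by rewrite subsetEset !C_principalE => t /= /le_trans; apply.
Qed.

Lemma bigcap_generated (S : set (set F)) : S `<=` generated_sets (Delta up) ->
  generated_sets (Delta up) (\bigcap_(X in S) X).
Proof.
have [j jP] := completion_join => SG.
have SP X : S X -> C_ideal (Delta up) X /\ directed X.
  by move=> /SG /generated_setsE.
apply/generated_setsE; split.
  split=> [x y Sy xy X SX|x U xU US X SX].
    by apply: (SP X SX).1.1 xy; exact: Sy.
  by apply: (SP X SX).1.2 xU _ => u /US; exact.
split=> [|x y Sx Sy].
  (* The least element lies in every non-empty down-set, hence in the intersection, even that of an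
     empty family. *)
  exists (up \bot) => X /SP[[downX _] [[x Xx] _]].
  exact: downX Xx (up_bot_le x).
have := lexx (j x y); rewrite jP => /andP[xj yj].
exists (j x y); split=> // X SX; have [[downX _] [_ dirX]] := SP X SX.
have [z [Xz xz yz]] := dirX x y (Sx X SX) (Sy X SX).
by apply: downX Xz _; rewrite jP xz.
Qed.

(** * Completeness and the embedding *)

Local Notation G := (generated_dcpo (Delta up)).
Local Notation e := (fun a => to_generated (Delta up) (up a)).

Lemma generatedP (X : G) : C_ideal (Delta up) (val X) /\ directed (val X).
Proof. exact/generated_setsE/set_mem/valP. Qed.

Lemma to_generated_le x (X : G) : (to_generated (Delta up) x <= X) = val X x :> Prop.
Proof.
rewrite le_generatedE /= C_principalE; apply/propext; split=> [|Xx y /= yx].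
  by apply => /=.
exact: (generatedP X).1.1 Xx yx.
Qed.

Lemma generated_complete : complete_lattice G.
Proof.
have infG (S : set G) : exists m, infimums S m.
  have SG : val @` S `<=` generated_sets (Delta up).
    by move=> _ [X _ <-]; exact/set_mem/valP.
  exists (SigSub (mem_set (bigcap_generated SG)) : G).
  split=> [X SX|Y lY]; rewrite le_generatedE /= => x.
    by apply; exists X.
  by move=> Yx _ [X SX <-]; move: x Yx; rewrite -/(_ `<=` _) -le_generatedE; exact: lY.
(* A join is the meet of all upper bounds. *)
move=> S; split=> //; have [j [lj jmax]] := infG (ubound S).
by exists j; split=> // X SX; apply: jmax => Y; exact.
Qed.

Lemma to_generated_embedding : lattice_embedding e.
Proof.
split=> [a b eab|a b|a b].
- have le_of_eq c c' : e c = e c' -> c <= c'.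
    move=> ecc'; rewrite -up_mono; have: e c <= e c' by rewrite ecc'.
    by rewrite to_generated_le /= C_principalE.
  by apply: le_anti; rewrite !le_of_eq.
- split=> [_ [->|->]|Y lY]; rewrite ?to_generated_le /= ?C_principalE /= ?up_mono ?leIl ?leIr //.
  have Ya : Y <= e a by apply: lY; left.
  have Yb : Y <= e b by apply: lY; right.
  move: Ya Yb; rewrite !le_generatedE /= !C_principalE => Ya Yb y Yy /=.
  by rewrite le_up_meet; apply/andP; split; [exact: Ya | exact: Yb].
- split=> [_ [->|->]|Y uY]; rewrite ?to_generated_le /= ?C_principalE /= ?up_mono ?leUl ?leUr //.
  have [[downY _] [_ dirY]] := generatedP Y.
  have Ya : val Y (up a) by rewrite -to_generated_le; apply: uY; left.
  have Yb : val Y (up b) by rewrite -to_generated_le; apply: uY; right.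
  (* Directedness of [Y] turns membership of [up a] and [up b] into that of a common bound, which
     lies above [up (a]|[b)] since [up] preserves joins. *)
  have [z [Yz az bz]] := dirY _ _ Ya Yb.
  by apply: downY Yz _; rewrite up_join_le az.
Qed.

(** * Density and compactness *)

Lemma infimum_filter (Fi : set A) x :
  infimums (up @` Fi) x -> infimums (e @` Fi) (to_generated (Delta up) x).
Proof.
move=> [lx xmax]; split=> [_ [a Fa <-]|Y lY].
  by rewrite to_generated_le /= C_principalE; apply: lx; exists a.
rewrite le_generatedE /= C_principalE => y Yy /=; apply: xmax => _ [a Fa <-].
have : Y <= e a by apply: lY; exists a.
by rewrite le_generatedE /= C_principalE; apply.
Qed.

Lemma ideal_cone_generated I : lattice_ideal I ->
  generated_sets (Delta up) (ideal_cone I).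
Proof.
move=> idI; apply/generated_setsE.
by split; [exact: ideal_cone_C_ideal | exact: ideal_cone_directed].
Qed.

Lemma supremum_ideal I (idI : lattice_ideal I) :
  supremums (e @` I) (SigSub (mem_set (ideal_cone_generated idI)) : G).
Proof.
split=> [_ [a Ia <-]|Y uY]; first by rewrite to_generated_le; exists a.
rewrite le_generatedE /= => x [a Ia xa]; apply: (generatedP Y).1.1 xa.
by rewrite -to_generated_le; apply: uY; exists a.
Qed.

(** The hypothesis is exactly the ideal condition for [val X] to cover [x]; as [val X] is directed,
    this is a cover contained in the C-ideal itself. *)
Lemma generated_sub_cone (X : G) x :
  (forall I, lattice_ideal I -> val X `<=` ideal_cone I -> ideal_cone I x) ->
  val X x.
Proof.
move=> xI; have [[_ closedX] dirX] := generatedP X.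
by apply: closedX (@subset_refl _ _); split.
Qed.

Lemma to_generated_dense : dense e.
Proof.
move=> u v; rewrite le_generatedE -existsNP => -[x /not_implyP[ux vx]].
have [I [idI [vI xI]]] : exists I,
    lattice_ideal I /\ val v `<=` ideal_cone I /\ ~ ideal_cone I x.
  apply: contrapT => noI; apply: vx; apply: generated_sub_cone => I idI vI.
  by apply: contrapT => xI; apply: noI; exists I.
case: upP => _ _ /(_ x)[[neFx dirFx] infx] _.
(* A point [x] of [u] outside [v] supplies the filter, whose meet is [<x>]; a cone that contains [v]
   but misses [x] supplies the ideal. *)
exists [set a | x <= up a], I, (to_generated (Delta up) x).
exists (SigSub (mem_set (ideal_cone_generated idI)) : G); split=> //.
- split=> // [a b /= xa ab|a b /= xa xb]; last by rewrite le_up_meet xa.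
  by apply: le_trans xa _; rewrite up_mono.
- exact: infimum_filter.
- exact: supremum_ideal.
- split; rewrite ?to_generated_le // le_generatedE //= => uI.
  by apply: xI; exact: uI.
Qed.

Lemma to_generated_compact : compact e.
Proof.
move=> Fi I m j [[b0 Fb0] upFi meetFi] idI infm supj mj.
case: upP => coF _ _ compF.
have codirFi : codirected (up @` Fi).
  split=> [|_ _ [a Fa <-] [b Fb <-]]; first by exists (up b0), b0.
  exists (up (a `&` b)%O); split; rewrite ?up_mono ?leIl ?leIr //.
  by exists (a `&` b)%O => //; exact: meetFi.
have [x infx] := coF _ codirFi; move: mj.
(* By uniqueness, [m] is [<x>] and [j] is the cone of [I], so [m <= j] puts [x] below some [up a]
   with [a] in [I]; compactness of [up a] for co-directed meets then yields [b]. *)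
rewrite (is_subset1_infimums infm (infimum_filter infx)).
rewrite (is_subset1_supremums supj (supremum_ideal idI)) to_generated_le.
move=> [a Ia xa]; have [_ [b Fb <-]] := compF _ _ _ codirFi infx xa.
by rewrite up_mono => ba; exists b, a.
Qed.

End MeetCompletion.

Theorem theorem12 (d d' : Order.disp_t) (A : tbLatticeType d)
    (F : porderType d') (up : A -> F) :
  codirected_meet_completion up ->
  canonical_extension (fun a : A => to_generated (Delta up) (up a)).
Proof.
move=> upP; split.
- exact: generated_complete.
- exact: to_generated_embedding.
- exact: to_generated_dense.
- exact: to_generated_compact.
Qed.
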